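(* Let $\alpha$ be a fractional set with $\|\alpha\|>1$, let $k$ be a nonzero integer, and for each $n\ge 1$ suppose $S_n\subseteq\mathbb{Z}^n$ is drawn from $\alpha^n$. Then for every $n$ $$\mathbb{E}|S_n|=\|\alpha\|^n,\qquad \mathrm{Var}|S_n|\le\|\alpha\|^n,$$ and $$\lim_{n\to\infty}\big(\mathbb{E}|S_n+k\cdot S_n|\big)^{1/n}=\|\alpha+k\cdot\alpha\|.$$
   Context: A fractional dilate is a map $\gamma:\mathbb{Z}\to[0,\infty)$ with finite support $\mathrm{supp}(\gamma)$. Its size is $\|\gamma\|=\inf_{0\le p\le 1}\sum_{n\in\mathrm{supp}(\gamma)}\gamma(n)^p$. A fractional set is a fractional dilate $\alpha$ with $\alpha(n)\le 1$ for all $n\in\mathbb{Z}$. For fractional sets $\alpha,\beta$ and an integer $k$, $\alpha+k\cdot\beta$ is the fractional dilate $(\alpha+k\cdot\beta)(n)=\sum_{(i,j):\,i+kj=n}\alpha(i)\beta(j)$. A random set $S_n\subseteq\mathbb{Z}^n$ is drawn from $\alpha^n$ if each element of $\mathbb{Z}^n$ is chosen independently, and $(i_1,\dots,i_n)$ is chosen with probability $\alpha(i_1)\alpha(i_2)\cdots\alpha(i_n)$. For $A,B\subseteq\mathbb{Z}^n$, $A+k\cdot B=\{a+kb:a\in A,b\in B\}$. *)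

(* Defs.v *)
From HB Require Import structures.
From mathcomp Require Import all_boot all_order all_algebra finmap.
From mathcomp Require Import all_classical all_reals all_analysis.

Set Implicit Arguments.
Unset Strict Implicit.
Unset Printing Implicit Defensive.

Import Order.TTheory GRing.Theory Num.Theory.
Import numFieldNormedType.Exports.

Local Open Scope classical_set_scope.
Local Open Scope ring_scope.

Definition dilate_supp (R : realType) (g : int -> R) : set int :=
  [set n | g n != 0].

Definition fractional_dilate (R : realType) (g : int -> R) : Prop :=
  (forall n, 0 <= g n) /\ finite_set (dilate_supp g).

Definition fractional_set (R : realType) (a : int -> R) : Prop :=
  fractional_dilate a /\ (forall n, a n <= 1).

(* The restriction of the sum to the support matters only for p = 0, because
   0 `^ 0 = 1. *)
Definition dilate_size (R : realType) (g : int -> R) : R :=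
  inf [set \sum_(n \in dilate_supp g) g n `^ p | p in `[0, 1]%classic].

(* The index set is infinite, but for finitely supported a and b only finitely
   many terms are nonzero. *)
Definition dilate_add (R : realType) (k : int) (a b : int -> R) : int -> R :=
  fun n => \sum_(ij \in [set ij : int * int | ij.1 + k * ij.2 = n])
    a ij.1 * b ij.2.

Lemma fractional_dilate_add (R : realType) (k : int) (a b : int -> R) :
  fractional_dilate a -> fractional_dilate b ->
  fractional_dilate (dilate_add k a b).
Proof.
move=> [a0 fa] [b0 fb]; split=> [n|].
  by rewrite /dilate_add; apply: sumr_ge0 => ij _; exact: mulr_ge0.
apply: (@sub_finite_set _ _
  [set i + k * j | i in dilate_supp a & j in dilate_supp b]); last first.
  exact: finite_image2.
move=> n /= /eqP nz; apply: contrapT => nex; apply: nz.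
rewrite /dilate_add fsbig1// => -[i j] /= ijn; apply: contrapT => /eqP.
rewrite mulf_eq0 negb_or => /andP[ai bj]; apply: nex.
by exists i => //; exists j.
Qed.

Definition sum_dilate (n : nat) (k : int) (A B : set 'rV[int]_n) :
    set 'rV[int]_n :=
  [set a + k *: b | a in A & b in B].

Definition mutually_independent (R : realType) (d : measure_display)
    (T : measurableType d) (P : probability T R) (I : choiceType)
    (E : I -> set T) : Prop :=
  (forall i, measurable (E i)) /\
  (forall F : {fset I},
     P (\bigcap_(i in [set` F]) E i) = (\prod_(i <- F) P (E i))%E).

Definition drawn_from (R : realType) (d : measure_display)
    (T : measurableType d) (P : probability T R) (a : int -> R) (n : nat)
    (S : T -> set 'rV[int]_n) : Prop :=
  mutually_independent P (fun x : 'rV[int]_n => [set w | S w x]) /\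
  (forall x : 'rV[int]_n, P [set w | S w x] = (\prod_(i < n) a (x ord0 i))%:E).

(* Extended-real valued, since a random subset of Z^n may be infinite on a null
   event. *)
Definition expected_card (R : realType) (d : measure_display)
    (T : measurableType d) (P : probability T R) (n : nat)
    (S : T -> set 'rV[int]_n) : \bar R :=
  (\int[P]_w counting (S w))%E.

(* [variance] takes real-valued functions, so the cardinality of an infinite set
   is read as 0 here; this affects only a null event as soon as [expected_card]
   is finite. *)
Definition variance_card (R : realType) (d : measure_display)
    (T : measurableType d) (P : probability T R) (n : nat)
    (S : T -> set 'rV[int]_n) : \bar R :=
  variance P (fun w => fine (counting (S w)) : R).

(* Main.v *)
Require Import Defs.
From mathcomp Require Import all_boot all_order all_algebra finmap.
From mathcomp Require Import all_classical all_reals all_analysis.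
From mathcomp Require Import measurable_realfun ring lra.
Import Order.TTheory GRing.Theory Num.Theory.
Import numFieldNormedType.Exports.

Local Open Scope classical_set_scope.
Local Open Scope ring_scope.

(** Write [A] for the size of [alpha], [gamma] for [alpha + k . alpha], [G] for the
    size of [gamma], and [gamma^n x] for the product of the weights of the
    coordinates of [x] (likewise [alpha^n]).

    As [alpha <= 1], the infimum defining [A] is reached at [p = 1], so [A] is the
    total mass of [alpha]. Almost surely [S_n] lies in the finite grid of points
    with coordinates in the support, and its cardinality is a sum of independent
    indicators of total mean [A ^+ n]; its variance is at most its mean.

    For the sumset, [gamma^n x] is the sum over [y] of
    [alpha^n (x - k y) * alpha^n y], which is the expected number of
    representations [x = u + k y] with [u] and [y] in [S_n], except that a
    degenerate representation [u = y] has the larger probability [alpha^n y]. Up to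
    constants and the degenerate representations, the probability that [x] is hit
    is [min 1 (gamma^n x)]:
    - from above by a union bound; summed over [x], the degenerate representations
      cost at most [A ^+ n], and [A <= G] ([dilate_size_add_ge]), so that
      [min 1 t <= t `^ p] bounds the expectation by [2 * G ^+ n]
      ([expected_card_sumset_le]);
    - from below by the second moment method ([prob_union_ge]): two representations
      are independent unless they share a point, and each one shares a point with
      at most three, itself included, because [k != 0]. Hence the expectation is
      at least a quarter of the sum of [min 1 (gamma^n x)]
      ([expected_card_sumset_ge]).

    It remains to see that this sum grows like [G ^+ n]
    ([sum_min1_prod_weight_ge]), a large deviation estimate. Let [p] minimise
    [Z p = \sum_j gamma j `^ p] on [[0, 1]], so that [G = Z p]. In the grid with
    the weights [gamma^n x `^ p], of total mass [G ^+ n], the points where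
    [gamma^n x] is larger than [expR (e * n)] are bounded through
    [Z (p + h) * expR (- e * h)], and those where it is smaller than
    [expR (- e * n)] through [Z (p - h) * expR (- e * h)]. Minimality makes both
    less than [Z p] for a suitable small [h > 0], so what remains is the window in
    which [gamma^n x `^ p] and [min 1 (gamma^n x)] agree up to [expR (e * n)]. When
    [p] is an end point of [[0, 1]], one of the two sides has no such bound but
    does no harm either. *)

Set Implicit Arguments.
Unset Strict Implicit.
Unset Printing Implicit Defensive.

(** * Product weights on finite grids of lattice points *)

(** Enumerated by functions into [ordinal (size s)], so that a product of sums
    over [s] expands into a sum over the grid by [bigA_distr_bigA]. *)
Definition grid (n : nat) (s : seq int) : seq 'rV[int]_n :=
  [seq (\row_i nth 0 s (f i) : 'rV[int]_n)
     | f : {ffun 'I_n -> 'I_(size s)}].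

Definition prod_weight (R : realType) (g : int -> R) (n : nat)
    (x : 'rV[int]_n) : R := \prod_(i < n) g (x ord0 i).

Definition power_sum (R : realType) (g : int -> R) (s : seq int) (p : R) : R :=
  \sum_(j <- s) g j `^ p.

Lemma mem_grid (n : nat) (s : seq int) (x : 'rV[int]_n) :
  (x \in grid n s) = [forall i, x ord0 i \in s].
Proof.
apply/mapP/forallP => [[f _ ->] i|xs]; first by rewrite mxE mem_nth.
have lt_index i : (index (x ord0 i) s < size s)%N by rewrite index_mem.
exists [ffun i => Ordinal (lt_index i)]; first by rewrite mem_enum.
by apply/rowP => i; rewrite mxE ffunE /= nth_index.
Qed.

Lemma grid_uniq (n : nat) (s : seq int) : uniq s -> uniq (grid n s).
Proof.
move=> us; rewrite map_inj_uniq ?enum_uniq// => f f' /rowP eq_ff'.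
apply/ffunP => i; apply/val_inj/eqP.
by move/eqP: (eq_ff' i); rewrite !mxE nth_uniq.
Qed.

Lemma sum_grid_prod (R : realType) (n : nat) (s : seq int)
    (F : 'I_n -> int -> R) :
  \sum_(x <- grid n s) \prod_(i < n) F i (x ord0 i)
  = \prod_(i < n) \sum_(j <- s) F i j.
Proof.
have -> : \prod_(i < n) \sum_(j <- s) F i j
        = \prod_(i < n) \sum_(j < size s) F i (nth 0 s j).
  by apply: eq_bigr => i _; rewrite (big_nth 0) big_mkord.
rewrite bigA_distr_bigA big_map big_enum /=.
by apply: eq_bigr => f _; apply: eq_bigr => i _; rewrite mxE.
Qed.

Lemma prod_weight_ge0 (R : realType) (g : int -> R) (n : nat)
    (x : 'rV[int]_n) :
  (forall j, 0 <= g j) -> 0 <= prod_weight g x.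
Proof. by move=> g0; apply: prodr_ge0 => i _. Qed.

Lemma prod_weight_le1 (R : realType) (g : int -> R) (n : nat)
    (x : 'rV[int]_n) :
  (forall j, 0 <= g j) -> (forall j, g j <= 1) -> prod_weight g x <= 1.
Proof. by move=> g0 g1; apply: prodr_ile1 => i _; rewrite g0 g1. Qed.

Lemma prod_weight_eq0_notin_grid (R : realType) (g : int -> R) (n : nat)
    (s : seq int) (x : 'rV[int]_n) :
  (forall j, j \notin s -> g j = 0) -> x \notin grid n s ->
  prod_weight g x = 0.
Proof.
move=> gs; rewrite mem_grid => /forallPn[i xi].
by apply/eqP/prodf_eq0; exists i => //; rewrite gs.
Qed.

Lemma prod_weight_gt0 (R : realType) (g : int -> R) (n : nat) (s : seq int)
    (x : 'rV[int]_n) :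
  (forall j, j \in s -> 0 < g j) -> x \in grid n s -> 0 < prod_weight g x.
Proof.
by move=> gs; rewrite mem_grid => /forallP xs; apply: prodr_gt0 => i _; exact: gs.
Qed.

Lemma sum_prod_weight (R : realType) (g : int -> R) (n : nat) (s : seq int) :
  \sum_(x <- grid n s) prod_weight g x = (\sum_(j <- s) g j) ^+ n.
Proof. by rewrite (sum_grid_prod s (fun=> g)) prodr_const card_ord. Qed.

Lemma powR_prod (R : realType) (I : Type) (r : seq I) (F : I -> R) (p : R) :
  (forall i, 0 <= F i) -> (\prod_(i <- r) F i) `^ p = \prod_(i <- r) F i `^ p.
Proof.
move=> F0; elim: r => [|i r IH]; first by rewrite !big_nil powR1.
by rewrite !big_cons powRM ?IH// prodr_ge0.
Qed.

Lemma sum_prod_weight_powR (R : realType) (g : int -> R) (n : nat)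
    (s : seq int) (p : R) :
  (forall j, 0 <= g j) ->
  \sum_(x <- grid n s) prod_weight g x `^ p = power_sum g s p ^+ n.
Proof.
move=> g0; rewrite -(sum_prod_weight (fun j => g j `^ p)).
by apply: eq_bigr => x _; exact: powR_prod.
Qed.

(** * Exponential growth of the truncated product weight *)

(** The left side is [expR (- u) * (expR u - 1) ^+ 2], and
    [expR u - 1 <= u * expR u] for [0 <= u]. *)
Lemma expR_second_difference (R : realType) (u : R) :
  expR u + expR (- u) - 2 <= u ^+ 2 * expR `|u|.
Proof.
wlog u0 : u / 0 <= u => [hw|].
  have [/hw//|u0] := leP 0 u.
  have := hw (- u); rewrite opprK normrN sqrrN oppr_ge0 => /(_ (ltW u0)).
  by rewrite [expR (- u) + _]addrC.
rewrite ger0_norm//.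
set e := expR u; set e' := expR (- u).
have ee' : e * e' = 1 by rewrite /e /e' -expRD subrr expR0.
have e0 : 0 < e by exact: expR_gt0.
have e'0 : 0 < e' by exact: expR_gt0.
have h1 : 1 - u <= e' by exact: expR_ge1Dx.
have h2 : 1 + u <= e by exact: expR_ge1Dx.
have d0 : 0 <= e - 1 by lra.
have du : e - 1 <= u * e.
  have : e * (1 - u) <= e * e' by rewrite ler_pM2l.
  by rewrite ee'; lra.
have -> : e + e' - 2 = e' * (e - 1) ^+ 2.
  have -> : e' * (e - 1) ^+ 2 = e * (e * e') - 2 * (e * e') + e' by ring.
  by rewrite ee'; ring.
have -> : u ^+ 2 * e = e' * (u * e) ^+ 2.
  have -> : e' * (u * e) ^+ 2 = u ^+ 2 * e * (e * e') by ring.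
  by rewrite ee' mulr1.
by rewrite ler_pM2l// ler_sqr ?nnegrE ?mulr_ge0// ltW.
Qed.

Lemma power_sum_second_difference (R : realType) (g : int -> R) (s : seq int)
    (p : R) :
  (forall j, j \in s -> 0 < g j) ->
  exists2 C : R, 0 <= C & forall h, 0 <= h <= 1 ->
    power_sum g s (p + h) + power_sum g s (p - h)
    <= 2 * power_sum g s p + C * h ^+ 2.
Proof.
move=> gs.
exists (\sum_(j <- s) g j `^ p * (ln (g j) ^+ 2 * expR `|ln (g j)|)).
  by apply: sumr_ge0 => j _; rewrite mulr_ge0 ?powR_ge0// mulr_ge0 ?sqr_ge0 ?expR_ge0.
move=> h /andP[h0 h1].
rewrite /power_sum -big_split /= mulr_sumr mulr_suml -big_split /=.
rewrite big_seq [leRHS]big_seq; apply: ler_sum => j /gs gj.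
have gj0 : g j != 0 by rewrite gt_eqF.
rewrite !powRD ?gj0 ?implybT// -!mulrDr [2 * _]mulrC -!mulrA -mulrDr.
rewrite ler_wpM2l ?powR_ge0// -lerBlDl.
rewrite /powR (negbTE gj0) mulNr.
apply: (le_trans (expR_second_difference _)).
rewrite exprMn normrM (ger0_norm h0) -mulrA [leRHS]mulrC.
have -> : ln (g j) * (expR `|ln (g j)| * h ^+ 2) * ln (g j)
        = h ^+ 2 * (ln (g j) ^+ 2 * expR `|ln (g j)|) by ring.
by do 2![apply: ler_wpM2l; first exact: sqr_ge0]; rewrite ler_expR ler_piMl.
Qed.

(** If going left does not decrease [f], then a bounded second difference lets
    [f] grow at most quadratically to the right, which for small steps is less
    than the growth at any exponential rate [e]. *)
Lemma second_difference_step (R : realType) (f : R -> R) (C e q : R) :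
  0 <= C -> (forall h, 0 <= h <= 1 -> f h + f (- h) <= 2 * f 0 + C * h ^+ 2) ->
  0 < f 0 -> 0 < e -> 0 < q -> (forall h, 0 <= h <= q -> f 0 <= f (- h)) ->
  exists2 h, 0 < h & f h * expR (- (e * h)) < f 0.
Proof.
move=> C0 fC f0 e0 q0 fmin.
pose b := e * f 0 / (C + 1).
have C1 : 0 < C + 1 by rewrite ltr_wpDl.
have b0 : 0 < b by rewrite !mulr_gt0 ?invr_gt0.
pose h := Num.min (Num.min q 1) b.
have h0 : 0 < h by rewrite !lt_min q0 ltr01 b0.
have hq : h <= q by rewrite !ge_min lexx.
have h1 : h <= 1 by rewrite !ge_min lexx orbT.
have hb : h <= b by rewrite ge_min lexx orbT.
exists h => //.
rewrite expRN ltr_pdivrMr ?expR_gt0//.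
have e1 : f 0 * (1 + e * h) <= f 0 * expR (e * h).
  by rewrite ler_pM2l// expR_ge1Dx.
apply: lt_le_trans e1.
have fh : f h <= f 0 + C * h ^+ 2.
  have h01 : 0 <= h <= 1 by rewrite (ltW h0) h1.
  have h0q : 0 <= h <= q by rewrite (ltW h0) hq.
  by have := fC _ h01; have := fmin _ h0q; lra.
apply: (le_lt_trans fh); rewrite mulrDr mulr1 ltrD2l.
have -> : f 0 * (e * h) = f 0 * e * h by ring.
rewrite expr2 mulrA ltr_pM2r//.
apply: (@lt_le_trans _ _ ((C + 1) * h)); first by rewrite ltr_pM2r// ltrDl.
by move: hb; rewrite /b ler_pdivlMr// mulrC [f 0 * e]mulrC.
Qed.

(** Up to the factor [q], the truncation [min 1 y] dominates [y `^ p] on the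
    window [q^-1 <= y <= q]; the correction terms make the bound hold outside the
    window too. Above the window no correction is called for when [p = 0], below
    it none when [p = 1]; this is what lets [p] be an end point of [[0, 1]]. *)
Lemma powR_le_min1 (R : realType) (y q p h h' : R) :
  0 < y -> 1 <= q -> 0 <= p <= 1 -> 0 <= h -> 0 <= h' ->
  y `^ p <= q * Num.min 1 y
            + (if 0 < p then y `^ (p + h) * q `^ (- h) else 0)
            + (if p < 1 then y `^ (p - h') * q `^ (- h') else 0).
Proof.
move=> y0 q1 /andP[p0 p1] h0 h'0.
have q0 : 0 < q by exact: lt_le_trans q1.
have yn0 : y != 0 by rewrite gt_eqF.
have a0 : 0 <= (if 0 < p then y `^ (p + h) * q `^ (- h) else 0).
  by case: ifP => // _; rewrite mulr_ge0 ?powR_ge0.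
have b0 : 0 <= (if p < 1 then y `^ (p - h') * q `^ (- h') else 0).
  by case: ifP => // _; rewrite mulr_ge0 ?powR_ge0.
have c0 : 0 <= q * Num.min 1 y by apply: mulr_ge0; rewrite ?le_min ?ler01; exact: ltW.
have [qy|yq] := ltP q y.
  have [pgt0|] := ltP 0 p.
    rewrite pgt0 in a0 *.
    have : y `^ p <= y `^ (p + h) * q `^ (- h).
      rewrite powRD ?yn0 ?implybT// -mulrA ler_peMr ?powR_ge0//.
      rewrite powRN ler_pdivlMr ?powR_gt0// mul1r.
      by apply: ge0_ler_powR => //; apply: ltW.
    by lra.
  move=> ple0; have pE : p = 0 by apply/le_anti; rewrite ple0 p0.
  rewrite min_l; last by rewrite (le_trans q1)// ltW.
  have -> : y `^ p = 1 by rewrite pE powRr0.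
  by lra.
have [yq'|yq'] := ltP (q * y) 1.
  have qy0 : 0 <= q * y by rewrite mulr_ge0 ?ltW.
  have [plt1|] := ltP p 1.
    rewrite plt1 in b0 *.
    have : y `^ p <= y `^ (p - h') * q `^ (- h').
      rewrite powRD ?yn0 ?implybT// -mulrA ler_peMr ?powR_ge0//.
      rewrite [_ `^ (- h') * _]mulrC -powRM ?(ltW y0) ?(ltW q0)// powRN.
      rewrite invf_ge1 ?powR_gt0 ?mulr_gt0//.
      have <- : 1 `^ h' = 1 :> R by rewrite powR1.
      by apply: ge0_ler_powR; rewrite ?nnegrE ?ler01//; exact: ltW.
    by lra.
  move=> p1'; have pE : p = 1 by apply/le_anti; rewrite p1 p1'.
  have y1 : y <= 1 by apply: le_trans (ltW yq'); rewrite ler_peMl// ltW.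
  have -> : y `^ p = y by rewrite pE powRr1// ltW.
  have : y <= q * Num.min 1 y by rewrite min_r// ler_peMl// ltW.
  by lra.
suff : y `^ p <= q * Num.min 1 y by lra.
have [y1|y1] := leP 1 y.
  rewrite mulr1; apply: le_trans yq.
  by rewrite -[leRHS]powRr1 ?(ltW y0)// ler_powR.
apply: le_trans yq'; have <- : 1 `^ p = 1 :> R by rewrite powR1.
by apply: ge0_ler_powR; rewrite ?nnegrE ?ler01//; exact: ltW.
Qed.

(** The exponential rate of the truncated sum is the least power sum (an upper
    bound for it by [min 1 y <= y `^ p]): summing [powR_le_min1] over the grid
    with [q = expR e ^+ n], each correction term becomes the [n]-th power of a
    number strictly below [power_sum g s p]. *)
Lemma sum_min1_prod_weight_ge (R : realType) (g : int -> R) (s : seq int)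
    (p e : R) :
  (forall j, 0 <= g j) -> (forall j, j \in s -> 0 < g j) ->
  0 < power_sum g s p -> 0 <= p <= 1 -> 0 < e ->
  (forall r, 0 <= r <= 1 -> power_sum g s p <= power_sum g s r) ->
  \forall n \near \oo,
    (expR (- e) * power_sum g s p) ^+ n / 2
    <= \sum_(x <- grid n s) Num.min 1 (prod_weight g x).
Proof.
move=> g0 gs Z0 p01 e0 pmin; set Z := power_sum g s in Z0 pmin *.
have [p0 p1] := andP p01.
have [C C0 ZC] := power_sum_second_difference p gs.
have expq n t : (expR e ^+ n) `^ (- t) = expR (- (e * t)) ^+ n.
  by rewrite -!expRM_natl -expRM; congr expR; ring.
(* The bases c and c' of the two correction terms lie below Z p: at a minimum
   reached with p > 0 a step to the left does not decrease Z, so Z hardly grows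
   to the right, and symmetrically when p < 1. *)
have [h [h0 [c [c0 cZ cE]]]] : exists h, 0 <= h /\ exists c, [/\ 0 <= c, c < Z p &
    forall n, (0 < n)%N ->
    \sum_(x <- grid n s) (if 0 < p
       then prod_weight g x `^ (p + h) * (expR e ^+ n) `^ (- h) else 0) <= c ^+ n].
  have [pgt0|] := ltP 0 p; last first.
    exists 0; split => //; exists 0; split => // n n0.
    by rewrite big1// expr0n; case: n n0.
  have [h h0 hZ] : exists2 h, 0 < h & Z (p + h) * expR (- (e * h)) < Z p.
    have := @second_difference_step R (fun h => Z (p + h)) C e p C0.
    rewrite addr0; apply => // r /andP[r0 rp].
    by rewrite pmin// subr_ge0 rp lerBlDr ler_wpDr.
  exists h; split; first exact: ltW.
  exists (Z (p + h) * expR (- (e * h))); split => // [|n _].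
    by rewrite mulr_ge0 ?expR_ge0// sumr_ge0// => j _; exact: powR_ge0.
  by rewrite -mulr_suml sum_prod_weight_powR// exprMn expq.
have [h' [h'0 [c' [c'0 c'Z c'E]]]] : exists h, 0 <= h /\ exists c, [/\ 0 <= c, c < Z p &
    forall n, (0 < n)%N ->
    \sum_(x <- grid n s) (if p < 1
       then prod_weight g x `^ (p - h) * (expR e ^+ n) `^ (- h) else 0) <= c ^+ n].
  have [plt1|] := ltP p 1; last first.
    exists 0; split => //; exists 0; split => // n n0.
    by rewrite big1// expr0n; case: n n0.
  have [h' h'0 hZ] : exists2 h, 0 < h & Z (p - h) * expR (- (e * h)) < Z p.
    have := @second_difference_step R (fun h => Z (p - h)) C e (1 - p) C0.
    rewrite subr0; apply => // [r r01||r /andP[r0 rp]].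
    - by rewrite opprK addrC; exact: ZC.
    - by rewrite subr_gt0.
    - by rewrite opprK pmin// addr_ge0//=; lra.
  exists h'; split; first exact: ltW.
  exists (Z (p - h') * expR (- (e * h'))); split => // [|n _].
    by rewrite mulr_ge0 ?expR_ge0// sumr_ge0// => j _; exact: powR_ge0.
  by rewrite -mulr_suml sum_prod_weight_powR// exprMn expq.
have small r : 0 <= r -> r < Z p -> \forall n \near \oo, r ^+ n <= Z p ^+ n / 4.
  move=> r0 rZ.
  have /cvgrPdist_lt/(_ 4^-1) : (fun n => (r / Z p) ^+ n) @ \oo --> (0 : R).
    apply: cvg_expr; rewrite ger0_norm ?divr_ge0 ?(ltW Z0)//.
    by rewrite ltr_pdivrMr// mul1r.
  rewrite invr_gt0 ltr0n => /(_ isT); apply: filterS => n.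
  rewrite sub0r normrN ger0_norm ?exprn_ge0 ?divr_ge0 ?(ltW Z0)//.
  by rewrite expr_div_n ltr_pdivrMr ?exprn_gt0// mulrC => /ltW.
near=> n.
have n0 : (0 < n)%N by near: n; exact: nbhs_infty_gt.
have cn : c ^+ n <= Z p ^+ n / 4 by near: n; exact: small.
have c'n : c' ^+ n <= Z p ^+ n / 4 by near: n; exact: small.
have q1 : 1 <= expR e ^+ n.
  by rewrite exprn_ege1// -expR0 ler_expR ltW.
have : Z p ^+ n <= \sum_(x <- grid n s)
    (expR e ^+ n * Num.min 1 (prod_weight g x)
     + (if 0 < p
        then prod_weight g x `^ (p + h) * (expR e ^+ n) `^ (- h) else 0)
     + (if p < 1
        then prod_weight g x `^ (p - h') * (expR e ^+ n) `^ (- h') else 0)).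
  rewrite -sum_prod_weight_powR// big_seq [leRHS]big_seq; apply: ler_sum => x xs.
  by apply: powR_le_min1 => //; exact: prod_weight_gt0 xs.
rewrite !big_split /= -mulr_sumr => ZE.
have := cE _ n0; have := c'E _ n0 => E' E.
rewrite exprMn expRN exprVn -mulrA ler_pdivrMl ?exprn_gt0 ?expR_gt0//.
by lra.
Unshelve. all: by end_near.
Qed.

(** * The size of a fractional dilate *)

Lemma big_uniq_support (V : nmodType) (I : eqType) (r s : seq I) (F : I -> V) :
  uniq r -> uniq s ->
  (forall i, i \in r -> i \notin s -> F i = 0) ->
  (forall i, i \in s -> i \notin r -> F i = 0) ->
  \sum_(i <- r) F i = \sum_(i <- s) F i.
Proof.
move=> ur us Fr Fs.
rewrite (bigID (mem s)) /= [X in _ + X]big1_seq ?addr0; last first.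
  by move=> i /andP[]; move/[swap]; exact: Fr.
rewrite [RHS](bigID (mem r)) /= [X in _ = _ + X]big1_seq ?addr0; last first.
  by move=> i /andP[]; move/[swap]; exact: Fs.
rewrite -big_filter -[RHS]big_filter; apply: perm_big.
apply: uniq_perm; rewrite ?filter_uniq// => i.
by rewrite !mem_filter andbC.
Qed.

Definition supp_seq (R : realType) (g : int -> R) : seq int :=
  fset_set (dilate_supp g).

Lemma supp_seq_uniq (R : realType) (g : int -> R) : uniq (supp_seq g).
Proof. exact: fset_uniq. Qed.

Lemma mem_supp_seq (R : realType) (g : int -> R) (j : int) :
  fractional_dilate g -> (j \in supp_seq g) = (g j != 0).
Proof.
move=> [_ fg]; rewrite /supp_seq in_fset_set//.
by apply/idP/idP; rewrite inE.
Qed.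

Lemma supp_seq_gt0 (R : realType) (g : int -> R) (j : int) :
  fractional_dilate g -> j \in supp_seq g -> 0 < g j.
Proof.
by move=> fg; rewrite mem_supp_seq// => gj; rewrite lt_neqAle eq_sym gj fg.1.
Qed.

Lemma notin_supp_seq (R : realType) (g : int -> R) (j : int) :
  fractional_dilate g -> j \notin supp_seq g -> g j = 0.
Proof. by move=> fg; rewrite mem_supp_seq// negbK => /eqP. Qed.

Lemma continuous_power_sum (R : realType) (g : int -> R) (s : seq int) :
  (forall j, j \in s -> 0 < g j) -> continuous (power_sum g s).
Proof.
move=> gs.
have -> : power_sum g s = fun p => \sum_(j <- s) expR (p * ln (g j)).
  apply/funext => p; apply: eq_big_seq => j /gs gj.
  by rewrite /powR gt_eqF.
move=> p; apply: cvg_big => [|j _]; first exact: add_continuous.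
apply: (@cvg_comp _ _ _ (fun p => p * ln (g j)) expR).
  exact: mulrr_continuous.
exact: continuous_expR.
Qed.

Lemma dilate_size_min (R : realType) (g : int -> R) :
  fractional_dilate g ->
  exists p : R, [/\ 0 <= p <= 1, dilate_size g = power_sum g (supp_seq g) p &
    forall q, 0 <= q <= 1 ->
      power_sum g (supp_seq g) p <= power_sum g (supp_seq g) q].
Proof.
move=> fg.
have gs j : j \in supp_seq g -> 0 < g j by exact: supp_seq_gt0.
have [//|p pI pmin] := @EVT_min R (power_sum g (supp_seq g)) 0 1 ler01.
  exact/continuous_subspaceT/continuous_power_sum.
have p01 : 0 <= p <= 1 by move: pI; rewrite in_itv.
have sumE q : \sum_(n \in dilate_supp g) g n `^ q = power_sum g (supp_seq g) q.
  by rewrite fsbig_finite//; exact: fg.2.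
exists p; split; [exact: p01| |by move=> q q01; apply: pmin; rewrite in_itv].
rewrite /dilate_size; apply/le_anti/andP; split.
  apply: ge_inf; last by exists p => //; rewrite sumE.
  exists 0 => _ [q _ <-]; rewrite sumE.
  by apply: sumr_ge0 => j _; exact: powR_ge0.
apply: lb_le_inf; first by exists (power_sum g (supp_seq g) p), p.
by move=> _ [q qI <-]; rewrite sumE; exact: pmin.
Qed.

(** For weights in [[0, 1]] the power sum is nonincreasing in the exponent, so
    its infimum is reached at [p = 1]. *)
Lemma dilate_size_fractional_set (R : realType) (a : int -> R) :
  fractional_set a -> dilate_size a = \sum_(j <- supp_seq a) a j.
Proof.
move=> [fa a1]; have [p [/andP[p0 p1] -> pmin]] := dilate_size_min fa.
have sum1 : power_sum a (supp_seq a) 1 = \sum_(j <- supp_seq a) a j.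
  by apply: eq_bigr => j _; rewrite powRr1// fa.1.
apply/le_anti/andP; split; first by rewrite -sum1 pmin// ler01 lexx.
rewrite -sum1 /power_sum big_seq [leRHS]big_seq; apply: ler_sum => j /supp_seq_gt0 aj.
by rewrite powRr1 ?fa.1// -{1}[a j]powRr1 ?fa.1// ger_powR// aj// a1.
Qed.

(** A representation [n = i + k * j] is determined by [j]. *)
Lemma dilate_addE (R : realType) (k : int) (a b : int -> R) (n : int) :
  fractional_dilate b ->
  dilate_add k a b n = \sum_(j <- supp_seq b) a (n - k * j) * b j.
Proof.
move=> fb; rewrite /dilate_add.
have -> : [set ij : int * int | ij.1 + k * ij.2 = n]
        = (fun j => (n - k * j, j)) @` [set: int].
  apply/seteqP; split => [[i j] /= <-|_ [j _ <-] /=]; last by rewrite subrK.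
  by exists j => //; rewrite addrK.
rewrite fsbig_image /=; last by move=> i j _ _ [].
rewrite (fsbig_seq _ _ (supp_seq_uniq b)); apply/esym/fsbig_widen => //.
move=> j [_ /= jb]; rewrite [b j](notin_supp_seq fb) ?mulr0//.
exact/negP.
Qed.

Lemma powR_ge_min1 (R : realType) (y p : R) :
  0 < y -> 0 <= p <= 1 -> Num.min 1 y <= y `^ p.
Proof.
move=> y0 /andP[p0 p1]; have [y1|y1] := leP 1 y.
  by rewrite -[leLHS](powRr0 y) ler_powR.
by rewrite -{1}[y]powRr1 ?(ltW y0)// ger_powR// y0 ltW.
Qed.

(** The concave truncation [min 1] turns the weights [a j] of total mass [A >= 1]
    into the probability weights [a j / A]; hence [min 1 (dilate_add k a a)] has
    mass at least that of one copy of [a]. *)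
Lemma dilate_size_add_ge (R : realType) (k : int) (a : int -> R) :
  fractional_set a -> 1 < dilate_size a ->
  dilate_size a <= dilate_size (dilate_add k a a).
Proof.
move=> ha; have fa := ha.1; have a0 := fa.1; have a1 := ha.2.
rewrite (dilate_size_fractional_set ha); set A := \sum_(j <- _) _ => A1.
set c := dilate_add k a a.
have fc : fractional_dilate c by exact: fractional_dilate_add.
have [p [p01 -> _]] := dilate_size_min fc.
have A0 : 0 < A by exact: lt_trans A1.
have -> : A = \sum_(n <- supp_seq c) \sum_(j <- supp_seq a) a (n - k * j) * (a j / A).
  rewrite exchange_big /= (eq_big_seq (fun j => A * (a j / A))) => [|j js].
    by rewrite -mulr_sumr -mulr_suml divff ?mulr1// gt_eqF.
  rewrite -mulr_suml; congr (_ * _); symmetry.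
  rewrite (@big_uniq_support _ _ _ [seq i + k * j | i <- supp_seq a]) ?supp_seq_uniq//.
  - by rewrite big_map; apply: eq_bigr => i _; rewrite addrK.
  - by rewrite map_inj_uniq ?supp_seq_uniq//; exact: addIr.
  - move=> n _ nj; apply: notin_supp_seq => //; apply: contra nj => nj.
    by apply/mapP; exists (n - k * j); rewrite ?subrK.
  - move=> _ /mapP[i /supp_seq_gt0 ai ->]; rewrite mem_supp_seq// negbK /c.
    rewrite dilate_addE// => /eqP.
    have : 0 < \sum_(j0 <- supp_seq a) a (i + k * j - k * j0) * a j0.
      rewrite (big_rem j)//= addrK ltr_pwDl//.
        by rewrite mulr_gt0 ?ai//; exact: supp_seq_gt0 js.
      by apply: sumr_ge0 => l _; exact: mulr_ge0.
    by move/gt_eqF/eqP.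
rewrite /power_sum big_seq [leRHS]big_seq; apply: ler_sum => n nc.
have cn0 := supp_seq_gt0 fc nc.
apply: le_trans (powR_ge_min1 cn0 p01).
rewrite le_min; apply/andP; split.
  apply: (@le_trans _ _ (\sum_(j <- supp_seq a) a j / A)).
    by apply: ler_sum => j _; rewrite ler_piMl// divr_ge0// ltW.
  by rewrite -mulr_suml divff// gt_eqF.
rewrite /c dilate_addE//; apply: ler_sum => j _.
by rewrite ler_wpM2l// ler_piMr// invf_le1// ltW.
Qed.

Lemma prod_weight_dilate_add (R : realType) (k : int) (a b : int -> R)
    (n : nat) (x : 'rV[int]_n) :
  fractional_dilate b ->
  prod_weight (dilate_add k a b) x
  = \sum_(y <- grid n (supp_seq b)) prod_weight a (x - k *: y) * prod_weight b y.
Proof.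
move=> fb; rewrite /prod_weight.
under eq_bigr do rewrite dilate_addE//.
rewrite -(sum_grid_prod _ (fun i j => a (x ord0 i - k * j) * b j)).
apply: eq_bigr => y _; rewrite big_split /=; congr (_ * _).
by apply: eq_bigr => i _; rewrite !mxE.
Qed.

(** * Cardinality of a random set of lattice points *)

Lemma counting_image_inj (U V : choiceType) (R : realType) (f : U -> V)
    (A : set U) :
  injective f -> counting (f @` A) = counting A :> \bar R.
Proof.
move=> inj_f; rewrite /counting.
have fA : (f @` A #= A)%card by apply: inj_card_eq => x y _ _; exact: inj_f.
rewrite (eq_finite_set fA); case: ifPn => // /asboolP finA.
congr (_%:R%:E); apply/fcard_eq => //; exact: finite_image.
Qed.

Lemma counting_indic (U : choiceType) (R : realType) (A : set U) (r : seq U) :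
  uniq r -> A `<=` [set` r] ->
  counting A = (\sum_(x <- r) \1_A x)%:E :> \bar R.
Proof.
move=> ur Ar.
have finA : finite_set A by exact: sub_finite_set Ar _.
rewrite /counting (asboolT finA); congr EFin.
under eq_bigr do rewrite indicE.
rewrite -natr_sum -big_mkcond /= sum1_count -size_filter; congr _%:R.
apply: perm_size; apply: uniq_perm; rewrite ?fset_uniq ?filter_uniq// => x.
rewrite in_fset_set// mem_filter; apply/idP/andP => [xA|[]//].
by split=> //; move: xA; rewrite inE => /Ar.
Qed.

Lemma indic_iff (U V : Type) (R : realType) (A : set U) (B : set V) x y :
  (A x <-> B y) -> \1_A x = \1_B y :> R.
Proof.
move=> AB; rewrite !indicE; congr (nat_of_bool _)%:R.
by apply/idP/idP; rewrite !inE; apply AB.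
Qed.

Section RandomSet.
Context (R : realType) (d : measure_display) (T : measurableType d).
Context (P : probability T R).

Lemma integral_sum_indic (I : Type) (r : seq I) (c : I -> R) (A : I -> set T) :
  (forall i, 0 <= c i) -> (forall i, measurable (A i)) ->
  (\int[P]_w (\sum_(i <- r) c i * \1_(A i) w)%:E
   = \sum_(i <- r) (c i)%:E * P (A i))%E.
Proof.
move=> c0 mA.
under eq_integral do rewrite -sumEFin.
rewrite ge0_integral_sum//.
- apply: eq_bigr => i _.
  under eq_integral do rewrite EFinM.
  by rewrite ge0_integralZl_EFin// ?integral_indic ?setIT//; exact/measurable_EFinP.
- by move=> i; exact/measurable_EFinP/measurable_funM.
- by move=> i w _; rewrite lee_fin mulr_ge0.
Qed.

Lemma measurable_sum_indic (I : Type) (r : seq I) (c : I -> R)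
    (A : I -> set T) :
  (forall i, measurable (A i)) ->
  measurable_fun setT (fun w => \sum_(i <- r) c i * \1_(A i) w).
Proof. by move=> mA; apply: measurable_sum => i; exact: measurable_funM. Qed.

Context (V : countType) (S : T -> set V).
Hypothesis mS : forall x, measurable [set w | S w x].

(** Through [pickle], the cardinality of a countable random set is a series of
    indicator functions. *)
Lemma measurable_counting :
  measurable_fun setT (fun w => counting (S w) : \bar R).
Proof.
pose E (n : nat) := [set w | exists2 x, S w x & choice.pickle x = n].
have mE n : measurable (E n).
  have -> : E n = \bigcup_x ([set w | S w x] `&` [set _ | choice.pickle x = n]).
    apply/seteqP; split => [w [x Sx xn]|w [x _ [/= Sx xn]]]; first by exists x.
    by exists x.
  apply: countable_bigcupT_measurable => [|x]; first exact: countableP.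
  apply: measurableI => //; have [xn|xn] := eqVneq (choice.pickle x) n.
    by rewrite xn (_ : [set _ | _] = setT)//; exact/seteqP.
  by rewrite (_ : [set _ | _] = set0)//; apply/seteqP; split => // ? /= /eqP; exact/negP.
have dE i : (fun w => \d_i (choice.pickle @` S w) : \bar R) = EFin \o \1_(E i).
  by apply/funext => w; congr EFin; exact: indic_iff.
apply: (@emeasurable_fun_cvg _ _ _ _
    (fun n w => \sum_(0 <= i < n) \d_i (choice.pickle @` S w))%E).
  move=> n; apply: emeasurable_sum => i; rewrite dE.
  exact/measurable_EFinP/measurable_indic.
move=> w _; rewrite -(counting_image_inj R (S w) (pcan_inj (@choice.pickleK V))).
rewrite counting_dirac.
by apply: is_cvg_nneseries => i _ _; rewrite lee_fin.
Qed.

(** The points outside [r] are countably many, and each contributes a null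
    event. *)
Lemma negligible_outside (r : seq V) :
  (forall x, x \notin r -> P [set w | S w x] = 0) ->
  let N := [set w | ~ S w `<=` [set` r]] in measurable N /\ P N = 0.
Proof.
move=> Pr N.
pose E (n : nat) := if choice.unpickle n is Some x then
  if x \in r then set0 else [set w | S w x] else set0.
have -> : N = \bigcup_n E n.
  apply/seteqP; split => [w /existsNP[x /not_implyP[Sx xr]]|w [n _]].
    exists (choice.pickle x) => //; rewrite /E choice.pickleK.
    by case: ifPn => // xr'; exfalso; exact: xr.
  rewrite /E; case: choice.unpickle => // x; case: ifPn => // xr Sx.
  by move=> /(_ x Sx) /=; exact/negP.
have mE n : measurable (E n).
  by rewrite /E; case: choice.unpickle => // x; case: ifP.
have E0 n : P (E n) = 0.
  by rewrite /E; case: choice.unpickle => [x|//]; case: ifPn => // /Pr.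
split; first exact: bigcupT_measurable.
apply/eqP; rewrite -measure_le0.
rewrite (le_trans (measure_sigma_subadditive P mE _ _))//.
  exact: bigcupT_measurable.
by rewrite eseries0// => i _ _; exact: E0.
Qed.

Lemma ae_counting (r : seq V) : uniq r ->
  (forall x, x \notin r -> P [set w | S w x] = 0) ->
  {ae P, forall w,
     counting (S w) = (\sum_(x <- r) \1_[set w | S w x] w)%:E :> \bar R}.
Proof.
move=> ur /negligible_outside[mN N0]; exists [set w | ~ S w `<=` [set` r]].
split => // w /=; apply: contra_not => Sr; rewrite (counting_indic R ur Sr).
congr EFin; by apply: eq_bigr => x _; exact: indic_iff.
Qed.

Lemma expected_counting (r : seq V) : uniq r ->
  (forall x, x \notin r -> P [set w | S w x] = 0) ->
  (\int[P]_w counting (S w) = \sum_(x <- r) P [set w | S w x])%E.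
Proof.
move=> ur Pr.
rewrite (ge0_ae_eq_integral (g := fun w =>
  (\sum_(x <- r) 1 * \1_[set w | S w x] w)%:E))//.
- rewrite integral_sum_indic//; apply: eq_bigr => x _.
  by rewrite mul1e.
- exact: measurable_counting.
- exact/measurable_EFinP/measurable_sum_indic.
- by move=> w _; rewrite /counting; case: ifP => _; rewrite ?lee_fin ?leey.
- by move=> w _; rewrite lee_fin; apply: sumr_ge0 => x _; rewrite mul1r.
- apply: filterS (ae_counting ur Pr) => w -> _; congr EFin.
  by apply: eq_bigr => x _; rewrite mul1r.
Qed.

End RandomSet.

(** * The second moment method *)

Section UnionBounds.
Context (R : realType) (d : measure_display) (T : measurableType d).
Context (P : probability T R) (I : eqType) (r : seq I).
Context (B : I -> set T) (q : I -> R) (U : set T).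
Hypothesis mB : forall i, measurable (B i).
Hypothesis mU : measurable U.
Hypothesis UB : forall w, U w <-> exists2 i, i \in r & B i w.
Hypothesis PB : forall i, P (B i) = (q i)%:E.

Lemma prob_union_le : (P U <= (\sum_(i <- r) q i)%:E)%E.
Proof.
rewrite -sumEFin.
under eq_bigr do rewrite -PB -[P _]mul1e.
rewrite -(@integral_sum_indic _ _ _ P _ r (fun=> 1) B)//.
have <- : (\int[P]_w (\1_U w)%:E = P U)%E by rewrite integral_indic// setIT.
apply: ge0_le_integral => //.
- exact/measurable_EFinP/measurable_indic.
- exact/measurable_EFinP/measurable_sum_indic.
move=> w _; rewrite lee_fin indicE.
have sum0 : 0 <= \sum_(i <- r) 1 * \1_(B i) w :> R.
  by apply: sumr_ge0 => i _; rewrite mul1r.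
have [/[!inE] /UB[i ir Bi]|//] := boolP (w \in U).
rewrite (big_rem i)//= mul1r indicE mem_set// lerDl.
by apply: sumr_ge0 => j _; rewrite mul1r.
Qed.

Let m := \sum_(i <- r) q i.
Variable qq : I -> I -> R.
Hypothesis PBB : forall i j, P (B i `&` B j) = (qq i j)%:E.
Hypothesis qq_le : forall i, i \in r -> \sum_(j <- r) qq i j <= q i * (m + 3).

(** With [N] the number of the events that occur, the second moment of [N] is
    at most [m * (m + 3)]. For [t = (m + 3)^-1] the pointwise inequality
    [2 * t * N <= \1_U + t ^+ 2 * N ^+ 2] integrates to [m / (m + 3) <= P U]. *)
Lemma prob_union_ge : ((Num.min 1 m / 4)%:E <= P U)%E.
Proof.
have q0 i : 0 <= q i by rewrite -lee_fin -PB.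
have m0 : 0 <= m by exact: sumr_ge0.
have m3 : 0 < m + 3 by rewrite ltr_wpDl.
pose t := (m + 3)^-1.
have t0 : 0 < t by rewrite invr_gt0.
pose rr := [seq (i, j) | i <- r, j <- r].
have sumrr (F : I -> I -> R) :
    \sum_(z <- rr) F z.1 z.2 = \sum_(i <- r) \sum_(j <- r) F i j.
  by rewrite big_allpairs_dep.
have PUE : P U = (fine (P U))%:E by rewrite fineK// fin_num_measure.
have : (\int[P]_w (\sum_(i <- r) (2 * t) * \1_(B i) w)%:E <=
        \int[P]_w ((\1_U w)%:E +
          (\sum_(z <- rr) t ^+ 2 * \1_(B z.1 `&` B z.2) w)%:E))%E.
  apply: ge0_le_integral => //.
  - move=> w _; rewrite lee_fin; apply: sumr_ge0 => i _.
    by rewrite !mulr_ge0// ltW.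
  - exact/measurable_EFinP/measurable_sum_indic.
  - apply: emeasurable_funD; first exact/measurable_EFinP/measurable_indic.
    apply/measurable_EFinP/(@measurable_sum_indic _ _ _ _ rr (fun=> t ^+ 2)
      (fun z => B z.1 `&` B z.2)) => z.
    exact: measurableI.
  move=> w _; rewrite -EFinD lee_fin.
  rewrite -!mulr_sumr (sumrr (fun i j => \1_(B i `&` B j) w)).
  set N := \sum_(i <- r) \1_(B i) w.
  have -> : \sum_(i <- r) \sum_(j <- r) \1_(B i `&` B j) w = N * N.
    rewrite /N big_distrlr; apply: eq_bigr => i _; apply: eq_bigr => j _.
    by rewrite indicI.
  rewrite indicE; have [wU|wU] := boolP (w \in U).
    by rewrite /=; have := sqr_ge0 (1 - t * N); rewrite expr2; lra.
  rewrite (_ : N = 0) ?mulr0 ?addr0//.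
  apply: big1_seq => i /andP[_ ir]; rewrite indicE memNset// => Bi.
  by move/negP: wU; apply; rewrite inE; apply/UB; exists i.
rewrite ge0_integralD//; first last.
- apply/measurable_EFinP/(@measurable_sum_indic _ _ _ _ rr (fun=> t ^+ 2)
    (fun z => B z.1 `&` B z.2)) => z.
  exact: measurableI.
- by move=> w _; rewrite lee_fin; apply: sumr_ge0 => z _; rewrite mulr_ge0 ?sqr_ge0.
- exact/measurable_EFinP/measurable_indic.
rewrite integral_indic// setIT.
rewrite integral_sum_indic//; last by move=> _; rewrite mulr_ge0// ltW.
rewrite (@integral_sum_indic _ _ _ P _ rr (fun=> t ^+ 2) (fun z => B z.1 `&` B z.2))//;
  [|by move=> _; exact: sqr_ge0|by move=> z; exact: measurableI].
under eq_bigr do rewrite PB -EFinM.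
under [X in (_ <= _ + X)%E]eq_bigr do rewrite PBB -EFinM.
rewrite !sumEFin => ineqE.
have : ((\sum_(i <- r) 2 * t * q i)%:E <= (fine (P U))%:E
        + (\sum_(z <- rr) t ^+ 2 * qq z.1 z.2)%:E)%E by rewrite -PUE.
rewrite -EFinD PUE !lee_fin -!mulr_sumr (sumrr qq) -/m => ineq.
have qqm : \sum_(i <- r) \sum_(j <- r) qq i j <= m * (m + 3).
  by rewrite /m mulr_suml big_seq [leRHS]big_seq; apply: ler_sum.
have tm3 : t * (m + 3) = 1 by rewrite mulVf// gt_eqF.
have tm : t * m <= fine (P U).
  have : t ^+ 2 * \sum_(i <- r) \sum_(j <- r) qq i j <= t * m.
    have -> : t * m = t ^+ 2 * (m * (m + 3)).
      by transitivity (t * (m + 3) * (t * m)); [rewrite tm3 mul1r|ring].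
    by rewrite ler_wpM2l ?sqr_ge0.
  by lra.
apply: le_trans tm; have [m1|m1] := leP 1 m.
  have : t * 3 <= t * (3 * m) by rewrite ler_pM2l// ler_peMr.
  by rewrite mulrDr in tm3; lra.
have : t * m <= t * 1 by rewrite ler_pM2l// ltW.
have : t * (1 - m) * m >= 0 by rewrite !mulr_ge0 ?subr_ge0// ltW.
have : m = t * (m + 3) * m by rewrite tm3 mul1r.
by lra.
Qed.

End UnionBounds.

(** * The sumset of a drawn set *)

Lemma sum_eq_indicator_le1 (R : realType) (I J : eqType) (r : seq I)
    (f : I -> J) (y : J) :
  uniq r -> injective f -> \sum_(i <- r) (f i == y)%:R <= 1 :> R.
Proof.
move=> ur inj_f; rewrite -natr_sum -big_mkcond /= sum1_count.
rewrite -(count_map f (pred1 y)) count_uniq_mem ?map_inj_uniq//.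
by rewrite lern1 leq_b1.
Qed.

Lemma scale_row_inj (n : nat) (k : int) :
  k != 0 -> injective (fun x : 'rV[int]_n => k *: x).
Proof.
move=> k0 x y /rowP xy; apply/rowP => i.
by have := xy i; rewrite !mxE; exact: mulfI.
Qed.

Section DrawnSet.
Context (R : realType) (d : measure_display) (T : measurableType d).
Context (P : probability T R) (a : int -> R) (n : nat) (S : T -> set 'rV[int]_n).
Hypotheses (ha : fractional_set a) (hS : drawn_from P a S).

Local Notation row := 'rV[int]_n.
Local Notation E x := [set w | S w x].
Local Notation pw := (prod_weight a).
Local Notation pts := (grid n (supp_seq a)).

Let pw0 (x : row) : 0 <= pw x.
Proof. exact/prod_weight_ge0/ha.1.1. Qed.

Let pw1 (x : row) : pw x <= 1.
Proof. by apply: prod_weight_le1; [exact: ha.1.1|exact: ha.2]. Qed.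

Let pw_notin (x : row) : x \notin pts -> pw x = 0.
Proof. by apply: prod_weight_eq0_notin_grid => j; exact/notin_supp_seq/ha.1. Qed.

Let upts : uniq pts.
Proof. exact/grid_uniq/supp_seq_uniq. Qed.

Lemma drawn_measurable (x : row) : measurable (E x).
Proof. exact: hS.1.1. Qed.

Lemma drawn_prob (x : row) : P (E x) = (pw x)%:E.
Proof. exact: hS.2. Qed.

Definition fset_weight (F : {fset row}) : R := \prod_(x <- F) pw x.

Lemma drawn_prob_fset (F : {fset row}) :
  P (\bigcap_(x in [set` F]) E x) = (fset_weight F)%:E.
Proof. by rewrite hS.1.2 -prodEFin; apply: eq_bigr => x _; rewrite drawn_prob. Qed.

Lemma fset_weight_ge0 (F : {fset row}) : 0 <= fset_weight F.
Proof. exact: prodr_ge0. Qed.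

Lemma fset_weightU_disjoint (F G : {fset row}) :
  [disjoint F & G]%fset -> fset_weight (F `|` G)%fset = fset_weight F * fset_weight G.
Proof.
move=> FG; rewrite /fset_weight -big_cat /=; apply: perm_big.
apply: uniq_perm; first exact: fset_uniq.
  rewrite cat_uniq !fset_uniq andbT; apply/hasPn => x xG.
  by rewrite /=; move/fdisjointP_sym: FG => /(_ x xG).
by move=> x; rewrite mem_cat in_fsetU.
Qed.

Lemma fset_weightU_le (F G : {fset row}) :
  fset_weight (F `|` G)%fset <= fset_weight F.
Proof.
have -> : (F `|` G = F `|` (G `\` F))%fset.
  by apply/fsetP => x; rewrite !inE; case: (x \in F).
rewrite fset_weightU_disjoint; last first.
  by apply/fdisjointP => x xF; rewrite !inE xF.
rewrite ler_piMr ?fset_weight_ge0//.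
by apply: prodr_ile1 => x _; rewrite pw0 pw1.
Qed.

Lemma expected_card_drawn :
  expected_card P S = (dilate_size a ^+ n)%:E.
Proof.
rewrite /expected_card (expected_counting drawn_measurable upts); last first.
  by move=> x /pw_notin px; rewrite drawn_prob px.
under eq_bigr do rewrite drawn_prob.
by rewrite sumEFin sum_prod_weight dilate_size_fractional_set.
Qed.

Let prob_pair (x y : row) : P (E x `&` E y) = (fset_weight [fset x; y]%fset)%:E.
Proof.
by rewrite -drawn_prob_fset set_fsetU1 set_fset1 bigcap_setU1 bigcap_set1.
Qed.

Let pair_weight (x y : row) :
  fset_weight [fset x; y]%fset = if x == y then pw y else pw x * pw y.
Proof.
rewrite /fset_weight; case: eqVneq => [->|xy].
  by rewrite fsetUid big_seq_fset1.
by rewrite big_fsetU1 ?inE//= big_seq_fset1.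
Qed.

(** Only the diagonal terms of the second moment exceed their independent value,
    and they add at most the mean. *)
Lemma variance_card_drawn :
  (variance_card P S <= (dilate_size a ^+ n)%:E)%E.
Proof.
set mu := dilate_size a ^+ n.
have muE : \sum_(x <- pts) pw x = mu.
  by rewrite sum_prod_weight /mu dilate_size_fractional_set.
have mu0 : 0 <= mu by rewrite -muE sumr_ge0.
have notin_pts x : x \notin pts -> P (E x) = 0.
  by move=> /pw_notin px; rewrite drawn_prob px.
have aeX := ae_counting drawn_measurable upts notin_pts.
pose Y w : R := \sum_(x <- pts) 1 * \1_(E x) w.
have mY : measurable_fun setT Y.
  by apply: measurable_sum_indic => x; exact: drawn_measurable.
have YE w : Y w = \sum_(x <- pts) \1_(E x) w.
  by apply: eq_bigr => x _; rewrite mul1r.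
have mX : measurable_fun setT (fun w => fine (counting (S w)) : R).
  apply: (@measurableT_comp _ _ _ _ _ _ fine) => //.
  exact: (measurable_counting drawn_measurable).
have EY : (\int[P]_w (Y w)%:E = mu%:E)%E.
  rewrite integral_sum_indic//; last by move=> x; exact: drawn_measurable.
  under eq_bigr do rewrite drawn_prob mul1e.
  by rewrite sumEFin muE.
have EX : ('E_P[(fun w => fine (counting (S w)) : R)] = mu%:E)%E.
  rewrite unlock -EY; apply: ae_eq_integral => //; try exact/measurable_EFinP.
  by apply: filterS aeX => w -> _; rewrite YE.
have -> : variance_card P S = (\int[P]_w ((Y w - mu) ^+ 2)%:E)%E.
  rewrite /variance_card /variance unlock EX /= unlock.
  apply: ae_eq_integral => //.
  - apply/measurable_EFinP/measurable_funM; exact: measurable_funB.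
  - by apply/measurable_EFinP/measurable_funX; exact: measurable_funB.
  apply: filterS aeX => w cw _.
  by rewrite mulrfctE /= cw -YE expr2.
have EYY : (\int[P]_w ((Y w) ^+ 2)%:E <= (mu + mu ^+ 2)%:E)%E.
  pose rr := [seq (x, y) | x <- pts, y <- pts].
  have -> : (\int[P]_w ((Y w) ^+ 2)%:E =
      \int[P]_w (\sum_(z <- rr) 1 * \1_(E z.1 `&` E z.2) w)%:E)%E.
    apply: eq_integral => w _; rewrite YE expr2 big_distrlr big_allpairs_dep /=.
    congr EFin; apply: eq_bigr => x _; apply: eq_bigr => y _.
    by rewrite mul1r indicI.
  rewrite (@integral_sum_indic _ _ _ P _ rr (fun=> 1) (fun z => E z.1 `&` E z.2))//;
    last by move=> z; apply: measurableI; exact: drawn_measurable.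
  under eq_bigr do rewrite prob_pair mul1e.
  rewrite sumEFin lee_fin big_allpairs_dep /= -{1}muE expr2 -{1}muE mulr_suml.
  rewrite -big_split /=.
  apply: ler_sum => x _; rewrite -muE mulr_sumr.
  apply: (@le_trans _ _ (\sum_(y <- pts) ((y == x)%:R * pw x + pw x * pw y))).
    apply: ler_sum => y _; rewrite pair_weight eq_sym.
    case: eqVneq => [->|_]; last by rewrite mul0r add0r.
    by rewrite mul1r lerDl mulr_ge0.
  rewrite big_split /= lerD2r -mulr_suml ler_piMl//.
  by apply: (sum_eq_indicator_le1 R x upts) => ? ?.
have sum2 : (\int[P]_w ((Y w - mu) ^+ 2)%:E + (2 * mu * mu)%:E =
             \int[P]_w ((Y w) ^+ 2)%:E + (mu ^+ 2)%:E)%E.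
  have mY2 : measurable_fun setT (fun w => ((Y w) ^+ 2)%:E).
    exact/measurable_EFinP/measurable_funX.
  have intc (c : R) : (\int[P]_w c%:E = c%:E)%E.
    by rewrite integral_cst//= probability_setT mule1.
  rewrite -(intc (mu ^+ 2)) -ge0_integralD//; first last.
  - by move=> w _; rewrite lee_fin sqr_ge0.
  - by move=> w _; rewrite lee_fin sqr_ge0.
  have -> : ((2 * mu * mu)%:E = \int[P]_w ((2 * mu)%:E * (Y w)%:E))%E.
    rewrite ge0_integralZl_EFin//; first by rewrite EY EFinM.
    - by move=> w _; rewrite lee_fin YE sumr_ge0.
    - exact/measurable_EFinP.
    - by rewrite mulr_ge0.
  rewrite -ge0_integralD//; first last.
  - apply: emeasurable_funM => //; exact/measurable_EFinP.
  - by move=> w _; rewrite lee_fin mulr_ge0 ?mulr_ge0// YE sumr_ge0.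
  - by apply/measurable_EFinP/measurable_funX; exact: measurable_funB.
  - by move=> w _; rewrite lee_fin sqr_ge0.
  apply: eq_integral => w _; rewrite -EFinM -!EFinD; congr EFin; ring.
have : (\int[P]_w ((Y w - mu) ^+ 2)%:E + (2 * mu * mu)%:E <=
        (mu + mu ^+ 2)%:E + (mu ^+ 2)%:E)%E by rewrite sum2 leeD2r.
rewrite -EFinD -leeBrDr// -EFinB => /le_trans; apply.
by rewrite lee_fin; lra.
Qed.

Variable k : int.
Hypothesis hk : k != 0.

Local Notation c := (dilate_add k a a).
Local Notation sumset := (fun w => sum_dilate k (S w) (S w)).
Local Notation hits x := [set w | sumset w x].

Let fc : fractional_dilate c.
Proof. exact: fractional_dilate_add ha.1 ha.1. Qed.

Local Notation rep x y := (E (x - k *: y) `&` E y).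
Local Notation rep_set x y := [fset x - k *: y; y]%fset.

Let hit_by_support (x : row) := \bigcup_(y in [set` pts]) rep x y.

Let measurable_rep (x y : row) : measurable (rep x y).
Proof. by apply: measurableI; exact: drawn_measurable. Qed.

Let measurable_hit_by_support (x : row) : measurable (hit_by_support x).
Proof. exact: fin_bigcup_measurable. Qed.

Lemma sumset_measurable (x : row) : measurable (hits x).
Proof.
have -> : hits x = \bigcup_y rep x y.
  apply/seteqP; split => [w [u Su [y Sy uy]]|w [y _ [Su Sy]]].
    by exists y => //; split => //=; rewrite -uy addrK.
  by exists (x - k *: y) => //; exists y => //; rewrite subrK.
by apply: countable_bigcupT_measurable => // ; exact: countableP.
Qed.

Let prob_hits (x : row) : P (hits x) = P (hit_by_support x).
Proof.
have notin_pts y : y \notin pts -> P (E y) = 0.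
  by move=> /pw_notin py; rewrite drawn_prob py.
have [mN N0] := negligible_outside drawn_measurable notin_pts.
apply/eqP; rewrite eq_le; apply/andP; split; last first.
  rewrite le_measure ?inE//; first exact: sumset_measurable.
  move=> w [y _ [Su Sy]].
  by exists (x - k *: y) => //; exists y => //; rewrite subrK.
rewrite -(measureU0 (measurable_hit_by_support x) mN N0).
rewrite le_measure ?inE//; [exact: sumset_measurable|exact: measurableU|].
move=> w [u Su [y Sy uy]].
have [ypts|ypts] := boolP (y \in pts).
  by left; exists y => //; split => //=; rewrite -uy addrK.
by right => /(_ y Sy) /=; exact/negP.
Qed.

Let hit_by_supportP (x : row) (w : T) :
  hit_by_support x w <-> exists2 y, y \in pts & rep x y w.
Proof. by split => -[y]; exists y. Qed.

Let prob_rep (x y : row) : P (rep x y) = (fset_weight (rep_set x y))%:E.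
Proof. exact: prob_pair. Qed.

Let sum_rep_weight (x : row) :
  \sum_(y <- pts) pw (x - k *: y) * pw y = prod_weight c x.
Proof. by rewrite prod_weight_dilate_add//; exact: ha.1. Qed.

Let rep_weight_ge (x y : row) :
  pw (x - k *: y) * pw y <= fset_weight (rep_set x y).
Proof. by rewrite pair_weight; case: eqVneq => // _; rewrite ler_piMl. Qed.

Let rep_weight_le (x y : row) :
  fset_weight (rep_set x y)
  <= pw (x - k *: y) * pw y + (x - k *: y == y)%:R * pw y.
Proof.
rewrite pair_weight; case: eqVneq => _; last by rewrite mul0r addr0.
by rewrite mul1r lerDr mulr_ge0.
Qed.

(** Two representations [x = u + k *: y = u' + k *: y'] are independent unless
    they share a point, which for fixed [y] leaves only [y' = y], [y' = u] and
    [u' = y]. *)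
Let sum_rep_weightU (x y : row) :
  \sum_(z <- pts) fset_weight (rep_set x y `|` rep_set x z)%fset
  <= fset_weight (rep_set x y)
     * (\sum_(z <- pts) fset_weight (rep_set x z) + 3).
Proof.
set Fy := rep_set x y; set u := x - k *: y.
apply: (@le_trans _ _ (\sum_(z <- pts) (fset_weight Fy * fset_weight (rep_set x z)
   + fset_weight Fy * ((z == y)%:R + (z == u)%:R + (x - k *: z == y)%:R)))).
  apply: ler_sum => z _.
  have [disj|] := boolP [disjoint Fy & rep_set x z]%fset.
    by rewrite fset_weightU_disjoint// lerDl mulr_ge0 ?fset_weight_ge0.
  move=> ndisj; apply: (le_trans (fset_weightU_le _ _)).
  rewrite ler_wpDl ?mulr_ge0 ?fset_weight_ge0//.
  rewrite ler_peMr ?fset_weight_ge0//.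
  suff : [|| z == y, z == u | x - k *: z == y].
    by case: (z == y); case: (z == u); case: (x - k *: z == y) => //= _; lra.
  apply: contraNT ndisj; rewrite !negb_or => /and3P[zy zu xzy].
  apply/fdisjointP => v; rewrite !inE => /orP[] /eqP ->; rewrite negb_or.
    rewrite eq_sym in zu; rewrite zu andbT; apply: contra zy => /eqP/addrI/oppr_inj.
    by move/(scale_row_inj hk) => ->.
  by rewrite eq_sym xzy eq_sym zy.
rewrite big_split /= -!mulr_sumr -mulrDr ler_wpM2l ?fset_weight_ge0//.
rewrite lerD2l !big_split /=.
have h1 := @sum_eq_indicator_le1 R _ _ _ (fun z : row => z) y upts (fun _ _ => id).
have h2 := @sum_eq_indicator_le1 R _ _ _ (fun z : row => z) u upts (fun _ _ => id).
have h3 := @sum_eq_indicator_le1 R _ _ _ (fun z : row => x - k *: z) y upts.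
have /h3 : injective (fun z : row => x - k *: z).
  by move=> z z' /addrI/oppr_inj/(scale_row_inj hk).
by move: h1 h2 => /=; lra.
Qed.

Let prob_repI (x y z : row) :
  P (rep x y `&` rep x z)
  = (fset_weight (rep_set x y `|` rep_set x z)%fset)%:E.
Proof.
by rewrite -drawn_prob_fset set_fsetU bigcap_setU !set_fsetU1 !set_fset1
  !bigcap_setU1 !bigcap_set1.
Qed.

Lemma sumset_prob_ge (x : row) :
  ((Num.min 1 (prod_weight c x) / 4)%:E <= P (hits x))%E.
Proof.
rewrite prob_hits.
apply: le_trans (prob_union_ge (measurable_rep x) (measurable_hit_by_support x)
  (hit_by_supportP x) (prob_rep x) (prob_repI x)
  (fun y _ => sum_rep_weightU x y)).
rewrite lee_fin ler_pM2r ?invr_gt0// le_min !ge_min lexx /= -sum_rep_weight.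
by rewrite ler_sum ?orbT// => y _; exact: rep_weight_ge.
Qed.

Lemma sumset_prob_le (x : row) :
  (P (hits x) <= (Num.min 1 (prod_weight c x)
                  + \sum_(y <- pts) (x - k *: y == y)%:R * pw y)%:E)%E.
Proof.
rewrite prob_hits.
have sum0 : 0 <= \sum_(y <- pts) (x - k *: y == y)%:R * pw y.
  by apply: sumr_ge0 => y _; rewrite mulr_ge0.
have [_|_] := leP 1 (prod_weight c x).
  apply: (@le_trans _ _ 1%E); first exact: probability_le1.
  by rewrite lee_fin lerDl.
apply: (le_trans (prob_union_le (measurable_rep x) (measurable_hit_by_support x)
  (hit_by_supportP x) (prob_rep x))).
rewrite lee_fin -sum_rep_weight -big_split /=; apply: ler_sum => y _.
exact: rep_weight_le.
Qed.

Let sumset_prob_eq0 (x : row) : x \notin grid n (supp_seq c) -> P (hits x) = 0.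
Proof.
move=> xc.
have c0 : prod_weight c x = 0.
  by apply: prod_weight_eq0_notin_grid xc => j; exact: notin_supp_seq.
have rep0 y : y \in pts -> fset_weight (rep_set x y) = 0.
  move=> ypts; move/eqP: c0; rewrite -sum_rep_weight psumr_eq0; last first.
    by move=> z _; rewrite mulr_ge0.
  move=> /allP/(_ y ypts)/eqP; rewrite pair_weight.
  by case: eqVneq => // -> /eqP; rewrite mulf_eq0 orbb => /eqP.
rewrite prob_hits; apply/eqP; rewrite -measure_le0.
have := prob_union_le (measurable_rep x) (measurable_hit_by_support x)
  (hit_by_supportP x) (prob_rep x).
by rewrite big1_seq// => y /andP[_ /rep0].
Qed.

Lemma expected_card_sumset_ge :
  ((\sum_(x <- grid n (supp_seq c)) Num.min 1 (prod_weight c x) / 4)%:E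
   <= expected_card P sumset)%E.
Proof.
rewrite /expected_card (expected_counting sumset_measurable
  (grid_uniq n (supp_seq_uniq c)) sumset_prob_eq0).
by rewrite -sumEFin; apply: lee_sum => x _; exact: sumset_prob_ge.
Qed.

(** A union bound over the representations; the degenerate ones [x = y + k *: y],
    whose two summands coincide, contribute at most [dilate_size a ^+ n]. *)
Lemma expected_card_sumset_le : 1 < dilate_size a ->
  (expected_card P sumset <= (2 * dilate_size c ^+ n)%:E)%E.
Proof.
move=> a1.
rewrite /expected_card (expected_counting sumset_measurable
  (grid_uniq n (supp_seq_uniq c)) sumset_prob_eq0).
apply: (@le_trans _ _ (\sum_(x <- grid n (supp_seq c)) (Num.min 1 (prod_weight c x)
  + \sum_(y <- pts) (x - k *: y == y)%:R * pw y)%:E)%E).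
  by apply: lee_sum => x _; exact: sumset_prob_le.
rewrite sumEFin lee_fin big_split /= mulrDl mul1r; apply: lerD.
  have [p [p01 -> _]] := dilate_size_min fc.
  rewrite -sum_prod_weight_powR; last exact: fc.1.
  rewrite big_seq [leRHS]big_seq; apply: ler_sum => x xc.
  apply: powR_ge_min1 => //; apply: prod_weight_gt0 xc => j.
  exact: supp_seq_gt0.
apply: (@le_trans _ _ (dilate_size a ^+ n)); last first.
  have a_ge0 : 0 <= dilate_size a by apply: le_trans (ltW a1).
  have ac := dilate_size_add_ge k ha a1.
  by rewrite lerXn2r ?nnegrE//; exact: le_trans ac.
rewrite exchange_big /= dilate_size_fractional_set// -sum_prod_weight.
apply: ler_sum => y _; rewrite -mulr_suml ler_piMl//.
apply: (@sum_eq_indicator_le1 _ _ _ _ (fun x : row => x - k *: y)).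
  exact/grid_uniq/supp_seq_uniq.
exact: addIr.
Qed.

End DrawnSet.

(** * The limit of the roots *)

Lemma powR_root_expn (R : realType) (y : R) (n : nat) : (0 < n)%N -> 0 <= y ->
  (y ^+ n) `^ (n%:R^-1) = y.
Proof.
move=> n0 y0; rewrite -powR_mulrn// -powRrM divff ?powRr1//.
by rewrite pnatr_eq0 -lt0n.
Qed.

Lemma near_expn_le (R : realType) (z b : R) : 0 <= z < 1 -> 0 < b ->
  \forall n \near \oo, z ^+ n <= b.
Proof.
move=> /andP[z0 z1] b0.
have /cvgrPdist_lt/(_ b b0) : (fun n => z ^+ n) @ \oo --> (0 : R).
  by apply: cvg_expr; rewrite ger0_norm.
by apply: filterS => n; rewrite sub0r normrN ger0_norm ?exprn_ge0// => /ltW.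
Qed.

(** Constant factors disappear under the [n]-th root. *)
Lemma cvg_root_expn (R : realType) (u : nat -> R) (G : R) : 0 < G ->
  (forall n, (0 < n)%N -> 0 <= u n <= 2 * G ^+ n) ->
  (forall e, 0 < e -> \forall n \near \oo, (expR (- e) * G) ^+ n / 8 <= u n) ->
  (fun n => u n `^ (n%:R^-1)) @ \oo --> G.
Proof.
move=> G0 u_le u_ge; apply/cvgrPdist_le => eta eta0.
pose e := eta / (2 * G).
have e0 : 0 < e by rewrite divr_gt0// mulr_gt0.
have etaE : eta = 2 * e * G.
  by rewrite /e; field; rewrite gt_eqF.
have e1 : 1 - e <= expR (- e) by exact: expR_ge1Dx.
have e2 : 1 - 2 * e <= expR (- e) * expR (- e).
  rewrite -expRD; apply: le_trans (expR_ge1Dx _); lra.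
have z1 : 0 <= expR (- e) < 1 by rewrite expR_ge0 expR_lt1 oppr_lt0.
have z2 : 0 <= (1 + e)^-1 < 1.
  have e1' : 0 < 1 + e by rewrite addr_gt0.
  by rewrite invr_ge0 ltW//= invf_lt1// ltrDl.
near=> n.
have n0 : (0 < n)%N by near: n; exact: nbhs_infty_gt.
have /andP[u0 u2] := u_le n n0.
(* Large powers absorb the constants: 8^-1 into expR (- e) ^+ n and 2 into
   (1 + e) ^+ n. *)
have root_mono : {in Num.nneg &, {homo (fun x : R => x `^ (n%:R^-1)) : x y / x <= y}}.
  by apply: ge0_ler_powR; rewrite invr_ge0.
have expn8 : expR (- e) ^+ n <= 8^-1.
  by near: n; exact: near_expn_le.
have expn2 : (1 + e)^-1 ^+ n <= 2^-1 by near: n; exact: near_expn_le.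
have un : (expR (- e) * G) ^+ n / 8 <= u n by near: n; exact: u_ge.
have Ge0 : 0 <= expR (- e) * G by rewrite mulr_ge0 ?expR_ge0 ?ltW.
have lo : expR (- e) * (expR (- e) * G) <= u n `^ (n%:R^-1).
  have eGe0 : 0 <= expR (- e) * (expR (- e) * G) by rewrite mulr_ge0 ?expR_ge0.
  rewrite -[leLHS](@powR_root_expn _ _ n)//.
  apply: root_mono; rewrite ?nnegrE ?exprn_ge0//.
  by apply: le_trans un; rewrite exprMn mulrC ler_wpM2l// exprn_ge0.
have hi : u n `^ (n%:R^-1) <= (1 + e) * G.
  have eG0 : 0 <= (1 + e) * G by rewrite mulr_ge0 ?addr_ge0 ?ltW.
  rewrite -[leRHS](@powR_root_expn _ _ n)//.
  apply: root_mono; rewrite ?nnegrE ?exprn_ge0//.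
  apply: (le_trans u2); rewrite exprMn ler_wpM2r ?exprn_ge0 ?(ltW G0)//.
  by move: expn2; rewrite exprVn lef_pV2 ?posrE ?exprn_gt0 ?addr_gt0.
rewrite ler_norml etaE; apply/andP; split.
  have : e * G >= 0 by rewrite mulr_ge0 ?ltW.
  by lra.
have : (1 - 2 * e) * G <= expR (- e) * (expR (- e) * G).
  by rewrite mulrA ler_wpM2r// ltW.
by lra.
Unshelve. all: by end_near.
Qed.

Unset Implicit Arguments.

Theorem theorem4 (R : realType) (alpha : int -> R)
    (halpha : fractional_set alpha) (hsize : 1 < dilate_size alpha)
    (k : int) (hk : k != 0)
    (d : nat -> measure_display) (T : forall n : nat, measurableType (d n))
    (P : forall n : nat, probability (T n) R)
    (S : forall n : nat, T n -> set 'rV[int]_n)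
    (hS : forall n : nat, (0 < n)%N -> drawn_from (P n) alpha (S n)) :
  (forall n : nat, (0 < n)%N ->
     expected_card (P n) (S n) = (dilate_size alpha ^+ n)%:E /\
     (variance_card (P n) (S n) <= (dilate_size alpha ^+ n)%:E)%E) /\
  ((fun n : nat =>
      (expected_card (P n) (fun w => sum_dilate k (S n w) (S n w))
         `^ (n%:R^-1))%E) @ \oo
     --> (dilate_size (dilate_add k alpha alpha))%:E).
Proof.
split=> [n n0|].
  by split; [exact: (expected_card_drawn halpha (hS n n0))
            |exact: (variance_card_drawn halpha (hS n n0))].
set c := dilate_add k alpha alpha; set G := dilate_size c.
have fc : fractional_dilate c by exact: fractional_dilate_add halpha.1 halpha.1.
have G0 : 0 < G.
  apply: lt_le_trans (dilate_size_add_ge k halpha hsize).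
  exact: lt_trans hsize.
pose Ex n := expected_card (P n) (fun w => sum_dilate k (S n w) (S n w)).
have Ex_ge0 n : (0 <= Ex n)%E.
  apply: integral_ge0 => w _.
  by rewrite /counting; case: ifP => _; rewrite ?lee_fin ?leey.
have Ex_le n : (0 < n)%N -> (Ex n <= (2 * G ^+ n)%:E)%E.
  by move=> n0; exact: (expected_card_sumset_le halpha (hS n n0)).
have ExE n : (0 < n)%N -> Ex n = (fine (Ex n))%:E.
  by move=> n0; rewrite fineK// ge0_fin_numE// (le_lt_trans (Ex_le n n0))// ltry.
have lim : (fun n => fine (Ex n) `^ (n%:R^-1)) @ \oo --> G.
  apply: cvg_root_expn => // [n n0|e e0].
    by rewrite fine_ge0// -lee_fin -ExE// Ex_le.
  have [p [p01 GE pmin]] := dilate_size_min fc.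
  have := sum_min1_prod_weight_ge fc.1 (fun j => supp_seq_gt0 fc (j := j))
    _ p01 e0 pmin.
  rewrite -GE => /(_ G0) growth.
  near=> n.
  have n0 : (0 < n)%N by near: n; exact: nbhs_infty_gt.
  have growth_n : (expR (- e) * G) ^+ n / 2
      <= \sum_(x <- grid n (supp_seq c)) Num.min 1 (prod_weight c x).
    by near: n.
  rewrite -lee_fin -ExE//.
  apply: le_trans (expected_card_sumset_ge halpha (hS n n0) hk).
  by rewrite lee_fin -mulr_suml; lra.
apply/(neq0_fine_cvgP _ (lt0r_neq0 G0)); apply: cvg_trans lim.
apply: near_eq_cvg; near=> n.
have n0 : (0 < n)%N by near: n; exact: nbhs_infty_gt.
by rewrite /= -/(Ex n) (ExE n n0) poweR_EFin.
Unshelve. all: by end_near.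
Qed.
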